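(* Let $k\ge1$ and let $w$ be an affine permutation (a nonzero element of the affine nil-Coxeter monoid $\hat{\mathbb A}_k$). If $w=d_{A_n}d_{A_{n-1}}\cdots d_{A_1}$ is a maximal expression for $w$ as a cyclically decreasing product, then $A_{i+1}\subset A_i-1$ for each $i$. In particular, $(|A_1|,|A_2|,\dots,|A_n|)$ is a partition.
   Context: Fix $k\ge1$ and let $I=\mathbb Z/(k+1)\mathbb Z$ (indices are taken mod $k+1$). The affine nil-Coxeter monoid $\hat{\mathbb A}_k$ is generated by $a_i$ ($i\in I$) and an absorbing zero $0$, with relations $a_i^2=0$, $a_ia_j=a_ja_i$ for $j\notin\{i-1,i,i+1\}$, and (for $k\ge2$) $a_ia_{i+1}a_i=a_{i+1}a_ia_{i+1}$. Its nonzero elements are identified with affine permutations in $\tilde S_{k+1}$ (the affine Coxeter group of type $A_k^{(1)}$ with generators $s_i$) by sending $a_{w_1}\cdots a_{w_l}$ to $s_{w_1}\cdots s_{w_l}$ for reduced words. For $A\subsetneq I$, $d_A$ is the product of the $a_i$, $i\in A$, each occurring once, ordered so that whenever $j,j-1\in A$ the letter $a_j$ is to the left of $a_{j-1}$. An expression $w=d_{A_n}\cdots d_{A_1}$ with all $A_i\subsetneq I$ nonempty is maximal if its shape $(|A_1|,\dots,|A_n|)$ is lexicographically maximal among all such expressions of $w$. For $S\subset I$, $S-1:=\{s-1: s\in S\}$. *)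

(* Defs.v *)
From HB Require Import structures.
From mathcomp Require Import all_boot all_order all_algebra.
From mathcomp Require Import boolp.

Set Implicit Arguments.
Unset Strict Implicit.
Unset Printing Implicit Defensive.

Import GRing.Theory.

Local Open Scope quotient_scope.

(* The index set I = Z/(k+1)Z; 'Z_k.+1 has k+1 elements exactly when 1 <= k
   (for k = 0 it degenerates to Z/2Z), so all of this is meant for 1 <= k. *)
Notation affI k := ('Z_k.+1).

Section AffineNilCoxeter.
Variable k : nat.
Implicit Types (i j : affI k) (u v : seq (affI k)) (A : {set affI k}).

(* The free monoid on the generators with an absorbing zero (None) adjoined. *)
Definition word0 := option (seq (affI k)).
HB.instance Definition _ := Choice.on word0.

Definition word0_mul (x y : word0) : word0 :=
  match x, y with
  | Some u, Some v => Some (u ++ v)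
  | _, _ => None
  end.

(* The least congruence on word0 containing the defining relations. *)
Inductive nilcox_cong : word0 -> word0 -> Prop :=
| nilcox_refl x : nilcox_cong x x
| nilcox_sym x y : nilcox_cong x y -> nilcox_cong y x
| nilcox_trans y x z :
    nilcox_cong x y -> nilcox_cong y z -> nilcox_cong x z
| nilcox_mul x x' y y' :
    nilcox_cong x x' -> nilcox_cong y y' ->
    nilcox_cong (word0_mul x y) (word0_mul x' y')
| nilcox_nil i : nilcox_cong (Some [:: i; i]) None
| nilcox_comm i j :
    j \notin [:: i - 1; i; i + 1]%R ->
    nilcox_cong (Some [:: i; j]) (Some [:: j; i])
| nilcox_braid i :
    2 <= k ->
    nilcox_cong (Some [:: i; i + 1; i]%R) (Some [:: i + 1; i; i + 1]%R).

Definition nilcox_rel : rel word0 := fun x y => `[< nilcox_cong x y >].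

Lemma nilcox_rel_refl : reflexive nilcox_rel.
Proof. by move=> x; apply/asboolP; exact: nilcox_refl. Qed.

Lemma nilcox_rel_sym : symmetric nilcox_rel.
Proof. by move=> x y; apply/asboolP/asboolP; exact: nilcox_sym. Qed.

Lemma nilcox_rel_trans : transitive nilcox_rel.
Proof.
by move=> y x z /asboolP xy /asboolP yz; apply/asboolP; exact: nilcox_trans yz.
Qed.

Canonical nilcox_equiv :=
  EquivRel nilcox_rel nilcox_rel_refl nilcox_rel_sym nilcox_rel_trans.

Definition nilcox := {eq_quot nilcox_equiv}.
HB.instance Definition _ := Choice.on nilcox.
HB.instance Definition _ := EqQuotient.on nilcox.

Lemma nilcox_piP (x y : word0) :
  \pi_nilcox x = \pi_nilcox y <-> nilcox_cong x y.
Proof. by split=> [/eqmodP/asboolP|xy]; last apply/eqmodP/asboolP. Qed.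

Definition nilcox_mulg (x y : nilcox) : nilcox :=
  \pi_nilcox (word0_mul (repr x) (repr y)).

Lemma pi_nilcox_mulg (x y : word0) :
  nilcox_mulg (\pi_nilcox x) (\pi_nilcox y) = \pi_nilcox (word0_mul x y).
Proof.
by apply/nilcox_piP; apply: nilcox_mul; apply/nilcox_piP; rewrite reprK.
Qed.

Lemma nilcox_mulgA : associative nilcox_mulg.
Proof.
elim/quotW=> x; elim/quotW=> y; elim/quotW=> z.
rewrite (pi_nilcox_mulg y z) (pi_nilcox_mulg x y) !pi_nilcox_mulg.
by case: x => [u|//]; case: y => [v|//]; case: z => [w|//] /=; rewrite catA.
Qed.

Lemma nilcox_mul1g : left_id (\pi_nilcox (Some [::])) nilcox_mulg.
Proof. by move=> x; rewrite -[x]reprK pi_nilcox_mulg; case: (repr x). Qed.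

Lemma nilcox_mulg1 : right_id (\pi_nilcox (Some [::])) nilcox_mulg.
Proof.
by move=> x; rewrite -[x]reprK pi_nilcox_mulg; case: (repr x) => //= u; rewrite cats0.
Qed.

HB.instance Definition _ :=
  isMonoid.Build nilcox nilcox_mulgA nilcox_mul1g nilcox_mulg1.

Local Open Scope group_scope.

Definition nilcox0 : nilcox := \pi_nilcox None.

Definition gen i : nilcox := \pi_nilcox (Some [:: i]).

Lemma nilcox_mul0g (x : nilcox) : nilcox0 * x = nilcox0.
Proof. by rewrite -[x]reprK [LHS]pi_nilcox_mulg. Qed.

Lemma nilcox_mulg0 (x : nilcox) : x * nilcox0 = nilcox0.
Proof. by rewrite -[x]reprK [LHS]pi_nilcox_mulg; case: (repr x). Qed.

Lemma gen_word u : \prod_(i <- u) gen i = \pi_nilcox (Some u).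
Proof.
elim: u => [|i u IHu]; first by rewrite big_nil.
by rewrite big_cons IHu [LHS]pi_nilcox_mulg.
Qed.

Lemma gen_comm i j :
  j \notin [:: i - 1; i; i + 1]%R -> gen i * gen j = gen j * gen i.
Proof.
by move=> ij; rewrite [LHS]pi_nilcox_mulg [RHS]pi_nilcox_mulg;
  apply/nilcox_piP/nilcox_comm.
Qed.

(* u lists each element of A exactly once, with j to the left of j - 1
   whenever both lie in A. *)
Definition cyc_decreasing A u : bool :=
  perm_eq u (enum A) &&
  [forall j in A, (j - 1 \in A)%R ==> (index j u < index (j - 1)%R u)].

(* d_A; cycdecE below shows that the choice of the word u is immaterial, and
   cyc_decreasing_ex that such a word exists for every proper subset A. *)
Definition cycdec A : nilcox :=
  if [pick u : #|A|.-tuple (affI k) | cyc_decreasing A u] is Some u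
  then \prod_(i <- u) gen i else nilcox0.

Lemma cyc_decreasing_ex A :
  A != [set: affI k] -> exists u, cyc_decreasing A u.
Proof.
rewrite -subTset => /subsetPn[m _ mA].
pose le (x y : affI k) := (val (m - x)%R <= val (m - y)%R).
exists (sort le (enum A)); rewrite /cyc_decreasing perm_sort perm_refl /=.
apply/forall_inP => j jA; apply/implyP => j1A; rewrite ltnNge; apply/negP.
have jj1 : j != (j - 1)%R by rewrite eq_sym -subr_eq0 addrAC subrr sub0r oppr_eq0.
have mem_srt x : x \in A -> x \in sort le (enum A) by rewrite mem_sort mem_enum.
rewrite leq_eqVlt => /orP[/eqP ij|].
  have := congr1 (nth j (sort le (enum A))) ij.
  by rewrite !nth_index ?mem_srt// => e; rewrite e eqxx in jj1.
have le_trans : transitive le by move=> y x z; exact: leq_trans.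
have srt : sorted le (sort le (enum A)) by apply: sort_sorted => x y; exact: leq_total.
move=> /(sorted_ltn_index le_trans srt).
move=> /(_ (mem_srt _ j1A) (mem_srt _ jA)).
have mj1 : (m - (j - 1) = (m - j) + 1)%R by rewrite opprB addrA addrAC.
have : (m - (j - 1) != 0)%R by rewrite subr_eq0; apply: contraNneq mA => ->.
rewrite /le mj1; move: (m - j)%R => [x xlt].
rewrite -val_eqE /=.
rewrite [1 %% _]modn_small// addn1.
move: xlt; rewrite leq_eqVlt => /orP[/eqP->|xlt]; first by rewrite modnn.
by rewrite modn_small// ltnn.
Qed.

Lemma cyc_decreasing_uniq A u : cyc_decreasing A u -> uniq u.
Proof. by case/andP => /perm_uniq -> _; exact: enum_uniq. Qed.

Lemma cyc_decreasing_mem A u : cyc_decreasing A u -> u =i A.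
Proof. by case/andP => /perm_mem e _ x; rewrite e mem_enum. Qed.

Lemma cyc_decreasing_rem A a u1 u2 :
  cyc_decreasing A (u1 ++ a :: u2) -> cyc_decreasing (A :\ a) (u1 ++ u2).
Proof.
move=> cd; have U := cyc_decreasing_uniq cd; have M := cyc_decreasing_mem cd.
have pm : perm_eq (u1 ++ a :: u2) (a :: (u1 ++ u2)) by rewrite perm_catC /= perm_cons perm_catC.
have U' : uniq (a :: (u1 ++ u2)) by rewrite -(perm_uniq pm).
have M' x : (x \in u1 ++ u2) = (x \in A :\ a).
  rewrite !inE -M (perm_mem pm) inE; case: eqVneq => //= ->.
  by apply/negbTE; case/andP: U'.
apply/andP; split.
  apply: uniq_perm; [by case/andP: U' | exact: enum_uniq |].
  by move=> x; rewrite mem_enum M'.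
have I x y : x != a -> y != a ->
    (index x (u1 ++ a :: u2) < index y (u1 ++ a :: u2)) ->
    (index x (u1 ++ u2) < index y (u1 ++ u2)).
  move=> xa ya; rewrite !index_cat /= ![a == _]eq_sym (negbTE xa) (negbTE ya).
  case: ifP => xu1; case: ifP => yu1 //.
  - by move: xu1; rewrite -index_mem => xu1 _; exact: (leq_trans xu1 (leq_addr _ _)).
  - move: yu1; rewrite -index_mem => yu1 h.
    by have := leq_ltn_trans (leq_addr _ _) (ltn_trans h yu1); rewrite ltnn.
  - by rewrite !ltn_add2l ltnS.
case/andP: cd => _ /forall_inP cd.
apply/forall_inP => j; rewrite !inE => /andP[ja jA]; apply/implyP => /andP[j1a j1A].
by apply: I => //; exact: (implyP (cd j jA)).
Qed.

Lemma cyc_decreasing_prod A u v :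
  cyc_decreasing A u -> cyc_decreasing A v ->
  \prod_(i <- u) gen i = \prod_(i <- v) gen i.
Proof.
elim: u v A => [|a u IHu] v A cu cv.
  have := cyc_decreasing_mem cv; case: v cv => // b v cv /(_ b).
  by rewrite -(cyc_decreasing_mem cu) !inE eqxx.
have aA : a \in A by rewrite -(cyc_decreasing_mem cu) mem_head.
have av : a \in v by rewrite (cyc_decreasing_mem cv).
have /(_ a) := mem_rot; case/splitPr: av cv => v1 v2 cv _.
have Uv := cyc_decreasing_uniq cv.
have cu' := @cyc_decreasing_rem A a [::] u cu.
have cv' := cyc_decreasing_rem cv.
rewrite big_cons (IHu _ _ cu' cv') !big_cat big_cons /= !mulgA; congr (_ * _).
have av1 : a \notin v1.
  by move: Uv; rewrite cat_uniq /= negb_or => /and3P[_ /andP[]].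
have com b : b \in v1 -> b \notin [:: a - 1; a; a + 1]%R.
  move=> bv1; have bA : b \in A by rewrite -(cyc_decreasing_mem cv) mem_cat bv1.
  have iv : index b (v1 ++ a :: v2) < index a (v1 ++ a :: v2).
    by rewrite !index_cat bv1 (negbTE av1) /= eqxx addn0 index_mem.
  rewrite !inE !negb_or; apply/and3P; split; apply/negP => /eqP e.
  - case/andP: cv => _ /forall_inP/(_ _ aA)/implyP; rewrite -e => /(_ bA).
    by rewrite ltnNge (ltnW iv).
  - by move: bv1; rewrite e (negbTE av1).
  - case/andP: cu => _ /forall_inP/(_ _ bA)/implyP; rewrite e addrK => /(_ aA).
    by rewrite /= eqxx ltn0.
elim: v1 com {cv cv' Uv av1} => [|b v1 IHv] com; first by rewrite big_nil mulg1 mul1g.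
rewrite big_cons mulgA gen_comm ?com ?mem_head// -!mulgA; congr (_ * _).
by rewrite IHv// => c cv1; apply: com; rewrite inE cv1 orbT.
Qed.

Lemma cycdecE A u : cyc_decreasing A u -> cycdec A = \prod_(i <- u) gen i.
Proof.
move=> cu; rewrite /cycdec; case: pickP => [v cv|]; first exact: cyc_decreasing_prod cv cu.
have su : size u == #|A| by case/andP: cu => /perm_size ->; rewrite -cardE.
by move/(_ (Tuple su)); rewrite /= cu.
Qed.

(* [:: A_1; ...; A_n] stands for the product d_{A_n} ... d_{A_1}: the product
   is taken in reverse order. *)
Definition cycdec_expr (w : nilcox) (As : seq {set affI k}) : Prop :=
  all (fun A => (A != set0) && (A \proper [set: affI k])) As /\
  w = \prod_(A <- rev As) cycdec A.

Definition expr_shape (As : seq {set affI k}) : seqlexi nat := [seq #|A| | A <- As].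

Definition maximal_expr (w : nilcox) (As : seq {set affI k}) : Prop :=
  cycdec_expr w As /\
  forall Bs, cycdec_expr w Bs -> (expr_shape Bs <= expr_shape As)%O.

Definition shift_down A : {set affI k} := [set (s - 1)%R | s in A].

End AffineNilCoxeter.

Definition is_partition (s : seq nat) : bool := sorted geq s && all (leq 1) s.

(* Main.v *)
(** If [b] lies in [B = A_{i+1}] but [b + 1] does not lie in [A = A_i], choose
    such a [b] as low as possible in its cyclic interval of [B]; that interval
    begins with [J = {c, ..., b}], where [c - 1] is not in [B] and
    [c + 1, ..., b] are in [A].  If [c] is in [A] then [d_B d_A] has the factor
    [d_J d_J = 0].  Otherwise the braid relations give
    [d_J d_{J \ c} = d_{J \ b} d_J], so [d_B d_A = d_{B \ b} d_{A u c}], whose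
    shape is lexicographically larger. *)
Require Import Defs.
From mathcomp Require Import all_boot all_order all_algebra.

Set Implicit Arguments.
Unset Strict Implicit.
Unset Printing Implicit Defensive.

Import Order.TTheory GRing.Theory.

(** * Factoring [cycdec] over disjoint unions, and the relations between generators *)

Section CyclicallyDecreasing.
Variable k : nat.
Implicit Types (i j c x : affI k) (A B X Y : {set affI k}).
Local Open Scope group_scope.

(** A word for [X] followed by a word for [Y] is cyclically decreasing: the only pairs in the wrong
    order would be [j] in [Y] with [j - 1] in [X], which the last hypothesis excludes. *)
Lemma cycdecU X Y : [disjoint X & Y] -> X :|: Y != setT ->
  (forall j, j \in Y -> (j - 1)%R \notin X) ->
  cycdec (X :|: Y) = cycdec X * cycdec Y.
Proof.
move=> dXY pXY hXY.
have pX : X != setT.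
  by apply: contraNneq pXY => ->; rewrite setTU.
have pY : Y != setT.
  by apply: contraNneq pXY => ->; rewrite setUT.
have [u cu] := cyc_decreasing_ex pX; have [v cv] := cyc_decreasing_ex pY.
rewrite (cycdecE cu) (cycdecE cv) -big_cat; apply: cycdecE.
have mu := cyc_decreasing_mem cu; have mv := cyc_decreasing_mem cv.
apply/andP; split.
  apply: uniq_perm; last by move=> x; rewrite mem_enum mem_cat mu mv inE.
    rewrite cat_uniq (cyc_decreasing_uniq cu) (cyc_decreasing_uniq cv) andbT /=.
    by apply/hasPn => x /=; rewrite mu mv => xY; rewrite (disjointFl dXY xY).
  exact: enum_uniq.
apply/forall_inP => j; rewrite inE => jXY; apply/implyP; rewrite inE => j1XY.
rewrite !index_cat !mu; case jX: (j \in X); case j1X: (j - 1 \in X)%R.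
- by case/andP: cu => _ /forall_inP /(_ j jX) /implyP; apply.
- by rewrite -mu -index_mem in jX; apply: leq_trans jX (leq_addr _ _).
- by move: jXY; rewrite jX => /hXY; rewrite j1X.
- rewrite ltn_add2l; rewrite jX in jXY; rewrite j1X in j1XY.
  by case/andP: cv => _ /forall_inP /(_ j jXY) /implyP; apply.
Qed.

Lemma cycdec0 : cycdec (set0 : {set affI k}) = 1.
Proof.
rewrite (@cycdecE _ set0 [::]) ?big_nil// /cyc_decreasing enum_set0 /=.
by apply/forall_inP => j; rewrite inE.
Qed.

Lemma cycdec1 i : cycdec [set i] = gen i.
Proof.
rewrite (@cycdecE _ [set i] [:: i]) ?big_seq1// /cyc_decreasing enum_set1 perm_refl /=.
apply/forall_inP => j; rewrite !inE => /eqP ->.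
by rewrite -subr_eq0 addrAC subrr sub0r oppr_eq0 oner_eq0.
Qed.

Lemma gen_sqr i : gen i * gen i = nilcox0 k.
Proof. by rewrite [LHS]pi_nilcox_mulg; apply/nilcox_piP/nilcox_nil. Qed.

Lemma gen_braid i : 2 <= k ->
  gen i * gen (i + 1)%R * gen i = gen (i + 1)%R * gen i * gen (i + 1)%R.
Proof.
move=> k2; rewrite !/(gen _ * gen _) [X in X * _]pi_nilcox_mulg.
rewrite [X in _ = X * _]pi_nilcox_mulg [LHS]pi_nilcox_mulg [RHS]pi_nilcox_mulg.
by apply/nilcox_piP/nilcox_braid.
Qed.

(** * Cyclic intervals of Z/(k+1) *)

Definition cyc_itv c m : {set affI k} := [set x | (x - c)%R < m].

Hypothesis k_gt0 : 0 < k.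

Lemma val_affI_nat t : t <= k -> (t%:R : affI k)%R = t :> nat.
Proof. by move=> tk; rewrite val_Zp_nat ?modn_small. Qed.

Lemma affI_lt (x : affI k) : x <= k.
Proof. by case: k k_gt0 x => // k' _ x; rewrite -ltnS; exact: ltn_ord. Qed.

Lemma affI_natr (x : affI k) : (x : nat)%:R%R = x.
Proof. exact: natr_Zp. Qed.

(** In the coordinate [t] measured upwards from [c], the set is {c, ..., c + m - 1} for [m <= k] and
    everything beyond. With [affI_addP] and [affI_add_inj] this turns questions about intervals into
    comparisons of naturals. *)
Lemma mem_cyc_itv c m t : t <= k -> (c + t%:R \in cyc_itv c m)%R = (t < m).
Proof. by move=> tk; rewrite inE addrAC subrr add0r val_affI_nat. Qed.

Lemma affI_addP c x : exists2 t, t <= k & x = (c + t%:R)%R.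
Proof.
exists (x - c)%R; first exact: affI_lt.
by rewrite affI_natr addrCA subrr addr0.
Qed.

Lemma affI_add_inj c s t : s <= k -> t <= k ->
  ((c + s%:R)%R == (c + t%:R)%R :> affI k) = (s == t).
Proof.
move=> sk tk; rewrite (inj_eq (addrI c)).
by apply/eqP/eqP => [/(congr1 val)/= | -> //]; rewrite !val_affI_nat.
Qed.

Lemma affI_pred_natr : (k%:R = -1 :> affI k)%R.
Proof.
apply/eqP; rewrite -subr_eq0 opprK natr1.
by apply/eqP/val_inj; rewrite /= val_Zp_nat ?modnn.
Qed.

Lemma cyc_itv0 c : cyc_itv c 0 = set0.
Proof. by apply/setP => x; rewrite !inE. Qed.

Lemma cyc_itvSr c m : m <= k -> cyc_itv c m.+1 = (c + m%:R)%R |: cyc_itv c m.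
Proof.
move=> mk; apply/setP => x; have [t tk ->] := affI_addP c x.
by rewrite in_setU1 affI_add_inj// !mem_cyc_itv// ltnS leq_eqVlt.
Qed.

Lemma cyc_itvSl c m : m <= k -> cyc_itv c m.+1 = c |: cyc_itv (c + 1)%R m.
Proof.
move=> mk; apply/setP => x; have [[|t] tk ->] := affI_addP c x.
  by rewrite in_setU1 mem_cyc_itv// addr0 eqxx.
rewrite in_setU1 mem_cyc_itv// -[X in _ == X]addr0 (@affI_add_inj c _ 0)//=.
by rewrite -nat1r addrA mem_cyc_itv// ltnW.
Qed.

Lemma cyc_itv_pred c m : m <= k -> (c - 1)%R \notin cyc_itv c m.
Proof. by move=> mk; rewrite -affI_pred_natr mem_cyc_itv// -leqNgt. Qed.

Lemma cyc_itv_succ c m : m <= k -> (c + m%:R)%R \notin cyc_itv c m.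
Proof. by move=> mk; rewrite mem_cyc_itv// ltnn. Qed.

Lemma cyc_itv_proper c m : m <= k -> cyc_itv c m != setT.
Proof.
by move=> mk; apply: contraNneq (cyc_itv_pred c mk) => ->; rewrite inE.
Qed.

Lemma notin_cyc_itvl c m : m <= k -> c \notin cyc_itv (c + 1)%R m.
Proof. by move=> mk; rewrite -{1}[c](addrK 1%R) cyc_itv_pred. Qed.

Lemma cyc_itvD1r c m : m <= k -> cyc_itv c m.+1 :\ (c + m%:R)%R = cyc_itv c m.
Proof. by move=> mk; rewrite cyc_itvSr// setU1K// cyc_itv_succ. Qed.

Lemma cyc_itv_step c m j : m <= k ->
  (j - 1)%R \in cyc_itv c m -> (j \in cyc_itv c m) || (j == c + m%:R)%R.
Proof.
move=> mk; have [t tk /eqP] := affI_addP c (j - 1)%R.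
rewrite subr_eq => /eqP ->; rewrite addrK mem_cyc_itv// => tm.
rewrite -addrA natr1 mem_cyc_itv ?(leq_trans tm)// affI_add_inj ?(leq_trans tm)//.
by rewrite orbC -leq_eqVlt.
Qed.

(** * Products of [cycdec] over cyclic intervals *)

Lemma cycdec_itvSr c m : m < k ->
  cycdec (cyc_itv c m.+1) = gen (c + m%:R)%R * cycdec (cyc_itv c m).
Proof.
move=> mk; rewrite cyc_itvSr ?(ltnW mk)// -cycdec1 cycdecU//.
- by rewrite disjoints1 cyc_itv_succ// ltnW.
- by rewrite -cyc_itvSr ?(ltnW mk)// cyc_itv_proper.
- move=> j; rewrite in_set1; apply: contraTneq => /eqP; rewrite subr_eq => /eqP ->.
  by rewrite -addrA natr1 mem_cyc_itv// -leqNgt.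
Qed.

(** Letters decrease from left to right, so the lowest letter [c] can be split off at the right end,
    just as the highest one is at the left end in [cycdec_itvSr]. *)
Lemma cycdec_itvSl c m : m < k ->
  cycdec (cyc_itv c m.+1) = cycdec (cyc_itv (c + 1)%R m) * gen c.
Proof.
move=> mk; have mk' := ltnW mk.
have c1 := notin_cyc_itvl c mk'.
rewrite cyc_itvSl// setUC -cycdec1 cycdecU//.
- by rewrite disjoint_sym disjoints1.
- by rewrite setUC -cyc_itvSl// cyc_itv_proper.
- move=> j; rewrite in_set1 => /eqP ->; apply: contra (cyc_itv_pred c mk) => h.
  by rewrite cyc_itvSl// in_setU1 h orbT.
Qed.

(** The letter [c + m.+1] has no neighbour in the interval: the gap [c + m] separates it from below,
    and [m.+1 < k] keeps its successor different from [c]. Hence [cycdecU] splits the union in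
    either order. *)
Lemma gen_cycdec_itv_comm c m : m.+1 < k ->
  gen (c + m.+1%:R)%R * cycdec (cyc_itv c m) =
  cycdec (cyc_itv c m) * gen (c + m.+1%:R)%R.
Proof.
move=> mk; have mk' := ltnW mk.
have nx t : m <= t -> t <= k -> (c + t%:R)%R \notin cyc_itv c m.
  by move=> mt tk; rewrite mem_cyc_itv// -leqNgt.
have dx : [disjoint [set (c + m.+1%:R)%R] & cyc_itv c m].
  by rewrite disjoints1 nx.
have px : (c + m.+1%:R)%R |: cyc_itv c m != setT.
  apply/eqP => /setP /(_ (c + m%:R)%R).
  rewrite in_setU1 in_setT affI_add_inj ?(ltnW mk')// ltn_eqF//=.
  by rewrite (negbTE (nx _ _ _))// ltnW.
rewrite -cycdec1 -cycdecU//; last first.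
  move=> j; rewrite in_set1; apply: contraTneq => /eqP; rewrite subr_eq => /eqP ->.
  by rewrite -addrA natr1 nx ?(leq_addl 2 m).
rewrite disjoint_sym in dx; rewrite setUC in px.
rewrite setUC cycdecU// => j; rewrite in_set1 => /eqP ->.
by rewrite -natr1 addrA addrK nx // ltnW.
Qed.

(** Induction on [m]. Let [D] and [E] be the products over the [m]-element intervals from [c] and
    [c + 1], and let [x], [y] be the generators at [c + m], [c + m.+1]. Then [y x D y E = y x y D E
    = x y x D E = x y D x D = x D y x D], by commutation, braid, induction hypothesis and
    commutation. *)
Lemma cycdec_itv_swap c m : m < k ->
  cycdec (cyc_itv c m.+1) * cycdec (cyc_itv (c + 1)%R m) =
  cycdec (cyc_itv c m) * cycdec (cyc_itv c m.+1).
Proof.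
elim: m => [|m IHm] mk; first by rewrite !cyc_itv0 cycdec0 mulg1 mul1g.
have mk' := ltnW mk.
have e : (c + 1 + m%:R = c + m.+1%:R)%R by rewrite -addrA nat1r.
have e' : (c + m%:R + 1 = c + m.+1%:R)%R by rewrite -addrA natr1.
have comm := gen_cycdec_itv_comm c mk.
rewrite (cycdec_itvSr c mk) (cycdec_itvSr (c + 1)%R mk') e {1}(cycdec_itvSr c mk').
rewrite !mulgA -(mulgA _ _ (gen (c + m.+1%:R)%R)) -comm !mulgA.
rewrite -e' -gen_braid ?e'; last exact: leq_trans mk.
rewrite -(mulgA _ (gen (c + m%:R)%R)) -cycdec_itvSr// -mulgA IHm// !mulgA.
by rewrite -(mulgA _ _ (cycdec (cyc_itv c m))) comm mulgA -cycdec_itvSr//.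
Qed.

(** Splitting [c] off the second factor and swapping leaves a product whose last two letters are
    both [c]. *)
Lemma cycdec_itv_sqr c m : m < k ->
  cycdec (cyc_itv c m.+1) * cycdec (cyc_itv c m.+1) = nilcox0 k.
Proof.
move=> mk; rewrite {2}cycdec_itvSl// mulgA cycdec_itv_swap// cycdec_itvSl//.
by rewrite -!mulgA gen_sqr !nilcox_mulg0.
Qed.

(** Since [c - 1] is missing from [B], no letter outside the interval has to stand to the right of
    one inside it. *)
Lemma cycdec_itv_right B c m : B != setT -> m <= k ->
  cyc_itv c m \subset B -> (c - 1)%R \notin B ->
  cycdec B = cycdec (B :\: cyc_itv c m) * cycdec (cyc_itv c m).
Proof.
move=> pB mk JB cB.
have E : (B :\: cyc_itv c m) :|: cyc_itv c m = B.
  by rewrite setUC -{1}(setIidPr JB) setID.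
rewrite -{1}E cycdecU ?E//.
  by rewrite -setI_eq0 setIDAC setDE -setIA setICr setI0.
move=> j jJ; rewrite in_setD negb_and negbK; apply/orP.
have [t tk jE] := affI_addP c j; move: jJ; rewrite jE mem_cyc_itv//.
case: t tk {jE} => [|t] tk tm; first by right; rewrite addr0.
by left; rewrite -natr1 addrA addrK mem_cyc_itv ?(ltnW tm) // ltnW.
Qed.

(** Dually, the missing successor [c + m] is the only letter that could be forced to stand to the
    left of the interval. *)
Lemma cycdec_itv_left A c m : A != setT -> m <= k ->
  cyc_itv c m \subset A -> (c + m%:R)%R \notin A ->
  cycdec A = cycdec (cyc_itv c m) * cycdec (A :\: cyc_itv c m).
Proof.
move=> pA mk JA cA.
have E : cyc_itv c m :|: (A :\: cyc_itv c m) = A.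
  by rewrite -{1}(setIidPr JA) setID.
rewrite -{1}E cycdecU ?E//.
  by rewrite -setI_eq0 setIDA setIC setDE -setIA setICr setI0.
move=> j; rewrite in_setD => /andP[jJ jA]; apply: contraNN cA => /cyc_itv_step.
by rewrite (negbTE jJ) => /(_ mk) /= /eqP <-.
Qed.

(** * Locating the lowest defect and exchanging a letter there *)

Lemma low_defect A B b : B != setT -> b \in B -> (b + 1)%R \notin A ->
  exists c m, [/\ m < k, (c - 1)%R \notin B, cyc_itv c m.+1 \subset B,
    cyc_itv (c + 1)%R m \subset A & (c + m.+1%:R)%R \notin A].
Proof.
move=> pB bB bA.
have exB : exists t, (b - t%:R)%R \notin B.
  have /subsetPn[x _ xB] : ~~ (setT \subset B) by rewrite subTset.
  have [t _ bE] := affI_addP x b.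
  by exists t; rewrite bE addrK.
(* Descend from [b] to the first letter outside [B]. The minimum is a successor because [b] is in
   [B], so [b - t] is the bottom of the run of [B] containing [b]. *)
have [[|t] tB tmin] := ex_minnP exB; first by rewrite subr0 bB in tB.
pose c := (b - t%:R)%R.
have cB : (c - 1)%R \notin B by rewrite /c -addrA -opprD natr1.
have cbB s : s <= t -> (c + s%:R)%R \in B.
  move=> st; apply: contraT => h; have := tmin (t - s).
  have -> : (b - (t - s)%:R = c + s%:R)%R by rewrite natrB// opprB addrCA addrC.
  by move=> /(_ h) /(leq_trans (ltnSn t)); rewrite ltnNge leq_subr.
(* Climb from [c] to the first later letter outside [A]; [b + 1] is such a letter, so the climb
   stays within the run. The lowest defect is then [c + m]. *)
have exA : exists m, (c + m.+1%:R)%R \notin A.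
  by exists t; rewrite -natr1 addrA /c addrNK.
have [m mA mmin] := ex_minnP exA.
have mt : m <= t by apply: mmin; rewrite -natr1 addrA /c addrNK.
(* Otherwise the run would reach [c + k], which is [c - 1]. *)
have mk : m < k.
  rewrite ltnNge; apply: contra cB => km; rewrite -affI_pred_natr.
  exact: cbB (leq_trans km mt).
exists c, m; split=> //; apply/subsetP => x.
  have [s sk ->] := affI_addP c x; rewrite mem_cyc_itv// ltnS => sm.
  exact: cbB (leq_trans sm mt).
have [s sk ->] := affI_addP (c + 1)%R x; rewrite mem_cyc_itv// => sm.
rewrite -addrA nat1r; apply: contraT => /mmin.
by rewrite leqNgt sm.
Qed.

Lemma cycdec_exchange A B b : A != setT -> B != setT ->
  b \in B -> (b + 1)%R \notin A -> cycdec B * cycdec A <> nilcox0 k ->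
  exists A' B', [/\ A' != setT, B' != setT, #|A'| = #|A|.+1 &
    cycdec B * cycdec A = cycdec B' * cycdec A'].
Proof.
move=> pA pB bB bA nz; have [c [m [mk cB JB JA mA]]] := low_defect pB bB bA.
have mk' := ltnW mk.
have cm : (c + 1 + m%:R = c + m.+1%:R)%R by rewrite -addrA nat1r.
have dB := cycdec_itv_right pB mk JB cB.
(* If [c] were in [A], the same interval could be split off at the right of [B] and at the left of
   [A], and its square would be zero. *)
have cA : c \notin A.
  apply/negP => cA; apply: nz.
  have JA' : cyc_itv c m.+1 \subset A by rewrite cyc_itvSl// subUset sub1set cA.
  rewrite dB (cycdec_itv_left pA mk JA' mA) -mulgA (mulgA (cycdec (cyc_itv _ _))).
  by rewrite cycdec_itv_sqr// nilcox_mul0g nilcox_mulg0.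
have mB : (c + m%:R)%R \in cyc_itv c m.+1 by rewrite mem_cyc_itv.
have pA' : c |: A != setT.
  apply/eqP => /setP /(_ (c + m.+1%:R)%R); rewrite in_setU1 (negbTE mA) in_setT.
  by rewrite -[X in _ == X]addr0 (@affI_add_inj c _ 0).
have JA' : cyc_itv c m.+1 \subset c |: A by rewrite cyc_itvSl// setUS.
have mA' : (c + m.+1%:R)%R \notin c |: A.
  by rewrite in_setU1 (negbTE mA) orbF -[X in _ == X]addr0 (@affI_add_inj c _ 0).
have pB' : B :\ (c + m%:R)%R != setT.
  by apply: contraNneq pB => e; rewrite -subTset -e subD1set.
have JB' : cyc_itv c m \subset B :\ (c + m%:R)%R.
  by rewrite -(cyc_itvD1r c mk') setSD.
have cB' : (c - 1)%R \notin B :\ (c + m%:R)%R by rewrite in_setD1 (negbTE cB) andbF.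
(* The bottom [c] of the interval joins [A], and its top [c + m] leaves [B], which may become
   empty. *)
exists (c |: A), (B :\ (c + m%:R)%R); split=> //; first by rewrite cardsU1 cA.
rewrite dB (cycdec_itv_left pA mk' JA) ?cm//.
rewrite (cycdec_itv_right pB' mk' JB' cB') (cycdec_itv_left pA' mk JA' mA').
(* The parts outside the intervals are unchanged on both sides, so only the middle factors need the
   swap. *)
have -> : (c |: A) :\: cyc_itv c m.+1 = A :\: cyc_itv (c + 1)%R m.
  rewrite cyc_itvSl//; apply/setP => x; rewrite !inE.
  by case: (eqVneq x c) => [->|] //=; rewrite (negbTE cA) andbF.
have -> : B :\ (c + m%:R)%R :\: cyc_itv c m = B :\: cyc_itv c m.+1.
  by rewrite cyc_itvSr// setDDl.
by rewrite -!mulgA; congr (_ * _); rewrite !mulgA cycdec_itv_swap.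
Qed.

End CyclicallyDecreasing.

(** * Lexicographic comparison of shapes and the conclusion *)

Lemma seqlexi_cat_lt (s t1 t2 : seq nat) (x y : nat) : x < y ->
  ((s ++ y :: t1 : seqlexi nat) <= (s ++ x :: t2))%O = false.
Proof.
move=> xy; elim: s => [|z s IHs] /=.
  by rewrite Order.SeqLexiOrder.lexi_cons leEnat leqNgt xy.
by rewrite Order.SeqLexiOrder.lexi_cons lexx /= IHs.
Qed.

Lemma maximal_expr_subset (k : nat) (w : nilcox k) (P Q : seq {set affI k})
    (A B : {set affI k}) : 0 < k -> w <> nilcox0 k ->
  maximal_expr w (P ++ A :: B :: Q) -> B \subset shift_down A.
Proof.
move=> k0 wn0 [[allAs wE] wmax].
apply/subsetP => b bB; apply: contraT => bA.
have {}bA : (b + 1)%R \notin A.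
  by apply: contraNN bA => h; apply/imsetP; exists (b + 1)%R; rewrite ?addrK.
move: allAs; rewrite all_cat /= !properT => /and4P[aP /andP[A0 pA] /andP[B0 pB] aQ].
have prodE C D : (\prod_(X <- rev (P ++ C :: D :: Q)) cycdec X
    = \prod_(X <- rev Q) cycdec X * (cycdec D * cycdec C)
      * \prod_(X <- rev P) cycdec X)%g.
  by rewrite rev_cat !rev_cons -!cats1 !big_cat /= !big_seq1 !mulgA.
rewrite prodE in wE.
have nz : (cycdec B * cycdec A <> nilcox0 k)%g.
  by move=> e; apply: wn0; rewrite wE e nilcox_mulg0 nilcox_mul0g.
have [A' [B' [pA' pB' cA' e]]] := cycdec_exchange k0 pA pB bB bA nz.
have A'0 : A' != set0 by rewrite -card_gt0 cA'.
(* The first difference between the shapes is at [A'], so the tail [D] is arbitrary; this covers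
   both keeping and dropping [B']. *)
have gt D : cycdec_expr w (P ++ A' :: D) -> False.
  move/wmax; rewrite /expr_shape !map_cat /=.
  by rewrite seqlexi_cat_lt// cA'.
(* Expressions admit no empty sets, so an empty [B'] is dropped; its factor is [1]. *)
case: (eqVneq B' set0) => [B'0|B'0].
  case: (gt Q); split; first by rewrite all_cat /= !properT aP A'0 pA' aQ.
  by rewrite wE e B'0 cycdec0 mul1g rev_cat rev_cons -cats1 !big_cat /= big_seq1.
case: (gt (B' :: Q)); split; last by rewrite prodE wE e.
by rewrite all_cat /= !properT aP A'0 pA' B'0 pB' aQ.
Qed.

Theorem proposition27 (k : nat) (w : nilcox k) (As : seq {set affI k}) :
  1 <= k -> w <> nilcox0 k -> maximal_expr w As ->
  (forall i, i.+1 < size As ->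
     nth set0 As i.+1 \subset shift_down (nth set0 As i)) /\
  is_partition (expr_shape As).
Proof.
move=> k0 wn0 wmax.
have sub i : i.+1 < size As ->
    nth set0 As i.+1 \subset shift_down (nth set0 As i).
  move=> iAs; apply: (@maximal_expr_subset k w (take i As) (drop i.+2 As)) => //.
  by rewrite -!drop_nth ?cat_take_drop // ltnW.
split=> //; apply/andP; split.
  apply/(sortedP 0) => i; rewrite size_map => iAs.
  rewrite /geq /= !(nth_map set0) ?(ltnW iAs)//.
  (* The shift is an image, so it cannot increase cardinality. *)
  exact: leq_trans (subset_leq_card (sub i iAs)) (leq_imset_card _ _).
rewrite all_map; case: wmax => [[+ _] _]; apply: sub_all => A /andP[A0 _] /=.
by rewrite card_gt0.
Qed.
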